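(* Let $(x_k,y_k)\in\mathbb{Z}^d\times\mathbb{Z}^d$ $(1\le k\le N-1)$ and $(\alpha,\beta)\in(\mathbb{R}^d\times\mathbb{R}^d)\setminus(\mathbb{Z}^d\times\mathbb{Z}^d)$, and assume that $0\ne f\in\mathcal{S}(\mathbb{R}^d)$ and $c_1,\dots,c_{N-1}\in\mathbb{C}$ satisfy $\sum_{k=1}^{N-1}c_kM_{y_k}T_{x_k}f=M_\beta T_\alpha f$. Let $\gamma=(-\alpha,\beta)$, $H=\overline{\{n\gamma\bmod\mathbb{Z}^{2d}:n\in\mathbb{Z}\}}\subset\mathbb{T}^{2d}$, $p(t,\omega)=\sum_{k=1}^{N-1}c_ke^{-2\pi i\langle y_k,t\rangle}e^{-2\pi i\langle\omega,x_k\rangle}$ and $S=\{z\in\mathbb{T}^{2d}:Zf(z)\ne0\}$. Then for every $z\in S$, the entire coset $z+H$ is contained in $S$. Moreover, for every $z\in S$, $$p(w)\ne0\qquad\text{for every }w\in z+H.$$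
   Context: Here $d\ge1$, $N\ge2$ are integers, $\langle\cdot,\cdot\rangle$ is the standard inner product on $\mathbb{R}^d$, $\mathcal{S}(\mathbb{R}^d)$ is the Schwartz space, and $\mathbb{T}^n=\mathbb{R}^n/\mathbb{Z}^n$; periodic functions on $\mathbb{R}^n$ are identified with functions on $\mathbb{T}^n$ (so $p$ is regarded as a function on $\mathbb{T}^{2d}$). Time-frequency shifts: $T_xf(t)=f(t-x)$, $M_yf(t)=e^{-2\pi i\langle y,t\rangle}f(t)$. Zak transform: $Zf(t,\omega)=\sum_{\kappa\in\mathbb{Z}^d}e^{-2\pi i\langle\omega,\kappa\rangle}f(t+\kappa)$ on $\mathbb{R}^d\times\mathbb{R}^d$. Its modulus is $\mathbb{Z}^{2d}$-periodic and continuous, so the condition $Zf(z)\neq0$ makes sense for $z\in\mathbb{T}^{2d}$. *)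

(* Defs.v *)
From HB Require Import structures.
From mathcomp Require Import all_boot all_order all_algebra.
From mathcomp Require Import generic_quotient ring_quotient.
From mathcomp Require Import finmap.
From mathcomp Require Import all_classical all_reals all_analysis.
From mathcomp.analysis.showcase Require summability.
From mathcomp.real_closed Require Import complex.

Set Implicit Arguments.
Unset Strict Implicit.
Unset Printing Implicit Defensive.

Import Order.TTheory GRing.Theory Num.Theory.
Import numFieldNormedType.Exports.

Local Open Scope classical_set_scope.
Local Open Scope ring_scope.
Local Open Scope complex_scope.
Local Open Scope quotient_scope.

Section Schwartz.
Context {R : realType} {d : nat}.
Implicit Types (f : 'rV[R]_d -> R[i]) (j : 'I_d).

(* MathComp-Analysis has no R-normed structure on R[i], so a complex-valued
   function of a real vector is differentiated through its two components. *)
Definition partial j f : 'rV[R]_d -> R[i] := fun t =>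
  'D_(delta_mx 0 j) (fun u => complex.Re (f u)) t +i*
  'D_(delta_mx 0 j) (fun u => complex.Im (f u)) t.

Definition has_partial j f := forall t,
  derivable (fun u => complex.Re (f u)) t (delta_mx 0 j) /\
  derivable (fun u => complex.Im (f u)) t (delta_mx 0 j).

Definition partials (s : seq 'I_d) f := foldr partial f s.

(* C^infinity: the iterated partial derivatives of all orders, taken in any
   order, exist and are continuous. *)
Definition smooth f := forall s : seq 'I_d,
  (forall j, has_partial j (partials s f)) /\
  continuous (partials s f : 'rV[R]_d -> R[i]^o).

Definition monomial (b : 'I_d -> nat) (t : 'rV[R]_d) : R :=
  \prod_(j < d) t 0 j ^+ b j.

Definition schwartz f := smooth f /\
  forall (b : 'I_d -> nat) (s : seq 'I_d), exists M : R, forall t,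
    `|(monomial b t)%:C * partials s f t| <= M%:C.

End Schwartz.

Section TimeFrequency.
Context {R : realType} {d : nat}.
Implicit Types (f : 'rV[R]_d -> R[i]) (x y t w : 'rV[R]_d).

Definition dot x y : R := \sum_(j < d) x 0 j * y 0 j.

Definition expi (s : R) : R[i] := cos s +i* sin s.

Definition vecint (k : 'rV[int]_d) : 'rV[R]_d := map_mx intr k.

Definition translation x f : 'rV[R]_d -> R[i] := fun t => f (t - x).

Definition modulation y f : 'rV[R]_d -> R[i] :=
  fun t => expi (- (2 * pi * dot y t)) * f t.

(* Unordered sum: the limit of the partial sums over the finite subsets of
   Z^d, ordered by inclusion. *)
Definition zak f t w : R[i] :=
  @summability.sum 'rV[int]_d R[i] R[i]^o
    (fun k => expi (- (2 * pi * dot w (vecint k))) * f (t + vecint k)).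

End TimeFrequency.

Section Torus.
Context {R : realType} {n : nat}.

Definition int_lattice : {pred 'rV[R]_n} :=
  fun u => [forall j, u 0 j \is a Num.int].

Lemma int_lattice_zmod : zmod_closed int_lattice.
Proof.
split=> [|u v /forallP hu /forallP hv]; apply/forallP => j.
  by rewrite mxE rpred0.
by rewrite !mxE rpredB.
Qed.

HB.instance Definition _ :=
  GRing.isZmodClosed.Build 'rV[R]_n int_lattice int_lattice_zmod.

Definition torus : Type := Quotient.quot int_lattice.

HB.instance Definition _ := GRing.Zmodule.on torus.

Definition tproj (u : 'rV[R]_n) : torus := \pi_(Quotient.quot int_lattice) u.

Lemma tprojB : {morph tproj : u v / u - v}.
Proof. by move=> u v; exact: raddfB. Qed.

Lemma tproj_eq (u v : 'rV[R]_n) :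
  (tproj u == tproj v) = (u - v \in int_lattice).
Proof. by rewrite /tproj piE. Qed.

Lemma tproj_surj (z : torus) : tproj (repr z) = z.
Proof. exact: reprK. Qed.

Definition torus_open (U : set torus) := open (tproj @^-1` U).

Fact torus_openT : torus_open setT.
Proof. by rewrite /torus_open preimage_setT; exact: openT. Qed.

Fact torus_openI : setI_closed torus_open.
Proof. by move=> A B oA oB; exact: openI. Qed.

Fact torus_open_bigU (I : Type) (F : I -> set torus) :
  (forall i, torus_open (F i)) -> torus_open (\bigcup_i F i).
Proof. by move=> oF; apply: bigcup_open => i _; exact: oF. Qed.

HB.instance Definition _ :=
  isOpenTopological.Build torus torus_openT torus_openI torus_open_bigU.

(* The function on the torus induced by a Z^n-periodic function (junk
   otherwise). *)
Definition on_torus {T : Type} (g : 'rV[R]_n -> T) : torus -> T :=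
  fun z => g (repr z).

Definition zperiodic {T : Type} (g : 'rV[R]_n -> T) :=
  forall u k, k \in int_lattice -> g (u + k) = g u.

Lemma on_torusE {T : Type} (g : 'rV[R]_n -> T) (u : 'rV[R]_n) :
  zperiodic g -> on_torus g (tproj u) = g u.
Proof.
move=> gP; rewrite /on_torus -[X in g X](subrK u) addrC gP//.
by rewrite -tproj_eq tproj_surj.
Qed.

End Torus.
Arguments torus : clear implicits.

Section Expi.
Context {R : realType}.
Implicit Types s t : R.

Lemma expiD s t : expi (s + t) = expi s * expi t.
Proof. by rewrite /expi cosD sinD; simpc; rewrite [X in _ +i* X]addrC. Qed.

Lemma expi0 : expi (0 : R) = 1.
Proof. by rewrite /expi cos0 sin0. Qed.

Lemma expiN_int s : s \is a Num.int -> expi (- (2 * pi * s)) = 1.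
Proof.
have expi_nat m : expi (2 * pi * m%:R : R) = 1.
  elim: m => [|m IH]; first by rewrite mulr0 expi0.
  rewrite -[m.+1]addn1 natrD mulrDr expiD IH mul1r mulr1 /expi.
  by rewrite mulrC mulr_natr cos2pi sin2pi.
move=> /intrP[m ->]; case: m => m; last first.
  by rewrite NegzE mulrNz mulrN opprK; exact: expi_nat.
have /(congr1 (fun z => expi (- (2 * pi * m%:R)) * z)) := expi_nat m.
by rewrite -expiD addNr expi0 mulr1 => <-.
Qed.

Lemma expiND s t :
  expi (- (2 * pi * (s + t))) = expi (- (2 * pi * s)) * expi (- (2 * pi * t)).
Proof. by rewrite [_ * (s + t)]mulrDr opprD expiD. Qed.

Lemma norm_expi s : `|expi s| = 1.
Proof. by rewrite normc_def /= cos2Dsin2 sqrtr1. Qed.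

End Expi.

Section Dot.
Context {R : realType} {d : nat}.
Implicit Types u v w : 'rV[R]_d.

Lemma dotDl u v w : dot (u + v) w = dot u w + dot v w.
Proof. by rewrite /dot -big_split; apply: eq_bigr => j _; rewrite mxE mulrDl. Qed.

Lemma dotDr u v w : dot w (u + v) = dot w u + dot w v.
Proof. by rewrite /dot -big_split; apply: eq_bigr => j _; rewrite mxE mulrDr. Qed.

Lemma dot_int u v :
  u \in int_lattice -> v \in int_lattice -> dot u v \is a Num.int.
Proof.
by move=> /forallP hu /forallP hv; apply: rpred_sum => j _; exact: rpredM.
Qed.

Lemma vecint_int (k : 'rV[int]_d) : (vecint k : 'rV[R]_d) \in int_lattice.
Proof. by apply/forallP => j; rewrite mxE intr_int. Qed.

Lemma vecintD (k l : 'rV[int]_d) : vecint (k + l) = vecint k + vecint l :> 'rV[R]_d.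
Proof. exact: raddfD. Qed.

Lemma vecintP u : u \in int_lattice -> exists k, u = vecint k.
Proof.
move=> /forallP hu; exists (map_mx Num.floor u); apply/rowP => j.
by rewrite !mxE floorK.
Qed.

End Dot.

Lemma sum_shift (I : zmodType) (K : numFieldType) (V : normedModType K) (g : I -> V) (a : I) :
  summability.sum (fun k => g (k + a)) = summability.sum g.
Proof.
pose sh (b : I) (A : {fset I}) : {fset I} := [fset (k + b)%R | k in A]%fset.
have shK b A : sh (- b) (sh b A) = A.
  apply/fsetP => k; apply/imfsetP/idP => [[_ /imfsetP[l lA ->] ->]|kA] /=.
    by rewrite addrK.
  by exists (k + b); rewrite ?addrK//; apply/imfsetP; exists k.
have shS b A B : (A `<=` B)%fset -> (sh b A `<=` sh b B)%fset.
  move=> /fsubsetP AB; apply/fsubsetP => _ /imfsetP[l lA ->].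
  by apply/imfsetP; exists l => //; exact: AB.
have psE A : summability.partial_sum (fun k => g (k + a)) A =
             summability.partial_sum g (sh a A).
  rewrite /summability.partial_sum.
  rewrite -(big_seq_fsetE _ A xpredT (fun k => g (k + a))).
  rewrite -(big_seq_fsetE _ (sh a A) xpredT g) eq_big_imfset ?big_map//=.
  by move=> k l _ _; exact: addIr.
rewrite /summability.sum; congr (lim _).
apply/funext => P; apply/propext; split => -[A _ AP].
  exists (sh a A) => // B AB /=.
  have /AP : (A `<=` sh (- a) B)%fset by rewrite -[A](shK a); exact: shS.
  by rewrite /= psE -[a in sh a]opprK shK.
exists (sh (- a) A) => // B AB /=; rewrite psE; apply: AP => /=.
by rewrite -[A](shK (- a)) opprK; exact: shS.
Qed.

Lemma norm_lim_scale (T : Type) (F : set_system T) (FF : ProperFilter F)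
    (K : numFieldType) (V : normedModType K) (h : T -> V) (e : K) :
  `|e| = 1 -> `|lim ((e *: h) @ F)| = `|lim (h @ F)|.
Proof.
move=> e1; have e0 : e != 0 by rewrite -normr_eq0 e1 oner_eq0.
have [hc|hc] := pselect (cvg (h @ F)).
  by rewrite limZl_tmp// normrZ e1 mul1r.
have hc' : ~ cvg (e *: h @ F) by rewrite is_cvgZlE.
by rewrite (dvgP hc) (dvgP hc').
Qed.

Section PhaseSpace.
Context {R : realType} {d : nat}.

(* A point (t, w) of R^d x R^d is encoded as row_mx t w. *)
Definition zak2 (f : 'rV[R]_d -> R[i]) (z : 'rV[R]_(d + d)) : R[i] :=
  zak f (lsubmx z) (rsubmx z).

Definition trig_poly (m : nat) (c : 'I_m -> R[i]) (x y : 'I_m -> 'rV[int]_d)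
    (z : 'rV[R]_(d + d)) : R[i] :=
  \sum_(k < m) c k * expi (- (2 * pi * dot (vecint (y k)) (lsubmx z)))
                   * expi (- (2 * pi * dot (rsubmx z) (vecint (x k)))).

Lemma trig_poly_zperiodic (m : nat) (c : 'I_m -> R[i])
    (x y : 'I_m -> 'rV[int]_d) : zperiodic (trig_poly c x y).
Proof.
move=> u v /vecintP[k ->]; apply: eq_bigr => j _.
have [lk rk] : lsubmx (vecint k) \in @int_lattice R d /\
               rsubmx (vecint k) \in @int_lattice R d.
  by split; apply/forallP => i; rewrite !mxE intr_int.
rewrite !raddfD/= dotDl dotDr !expiND.
have hy := dot_int (vecint_int (y j)) lk; have hx := dot_int rk (vecint_int (x j)).
by rewrite (expiN_int hy) (expiN_int hx) !mulr1.
Qed.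

Lemma norm_zak2_zperiodic (f : 'rV[R]_d -> R[i]) :
  zperiodic (fun z => `|zak2 f z|).
Proof.
move=> z v /vecintP[k ->]; rewrite /zak2.
set t := lsubmx z; set w := rsubmx z.
rewrite (_ : lsubmx _ = t + vecint (lsubmx k)); last first.
  by rewrite raddfD; congr (_ + _); apply/rowP => j; rewrite !mxE.
rewrite (_ : rsubmx _ = w + vecint (rsubmx k)); last first.
  by rewrite raddfD; congr (_ + _); apply/rowP => j; rewrite !mxE.
move: (lsubmx k) (rsubmx k) => a b; rewrite /zak.
set g := fun l => expi (- (2 * pi * dot w (vecint l))) * f (t + vecint l).
set e := expi (2 * pi * dot w (vecint a)).
rewrite (_ : (fun l => _) = fun l => e * g (l + a)); last first.
  apply/funext => l; rewrite /g /e dotDl expiND.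
  rewrite (expiN_int (dot_int (vecint_int _) (vecint_int _))) mulr1.
  rewrite vecintD dotDr expiND mulrA mulrCA -expiD subrr expi0 mulr1.
  by rewrite -addrA [vecint a + _]addrC.
rewrite -(@sum_shift _ _ R[i]^o g a) /summability.sum.
set h := fun l => g (l + a).
rewrite (_ : summability.partial_sum (fun l => e * h l) =
             e *: (summability.partial_sum (h : _ -> R[i]^o))); last first.
  by apply/funext => A; rewrite fctE; apply/esym/scaler_sumr.
exact: (@norm_lim_scale _ _ (@summability.totally_filter 'rV[int]_d) _ R[i]^o
  (summability.partial_sum (h : _ -> R[i]^o)) e (norm_expi _)).
Qed.

Definition orbit_closure (g : 'rV[R]_(d + d)) : set (torus R (d + d)) :=
  closure (range (fun n : int => tproj (g *~ n))).

(* Only the modulus of zak2 f is periodic, so the choice of representative in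
   on_torus is immaterial for its zero set; see zak_supportE. *)
Definition zak_support (f : 'rV[R]_d -> R[i]) : set (torus R (d + d)) :=
  [set z | on_torus (zak2 f) z != 0].

Lemma zak_supportE (f : 'rV[R]_d -> R[i]) (u : 'rV[R]_(d + d)) :
  zak_support f (tproj u) <-> zak2 f u != 0.
Proof.
have := on_torusE u (@norm_zak2_zperiodic f); rewrite /zak_support/= /on_torus => E.
by split; apply: contraNneq => E0; rewrite -normr_eq0; move: E; rewrite E0 normr0 => /eqP; rewrite // eq_sym.
Qed.

Definition torus_coset (z : torus R (d + d)) (H : set (torus R (d + d))) :=
  [set z + h | h in H].

End PhaseSpace.

(* Main.v *)
Require Import Defs.
From mathcomp Require Import all_boot all_order all_algebra.
From mathcomp Require Import finmap.
From mathcomp Require Import all_classical all_reals all_analysis.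
From mathcomp.analysis.showcase Require summability.
From mathcomp.real_closed Require Import complex.
From mathcomp Require Import ring lra zify.

(** Write [F] for the Zak transform of [f].  Applying the Zak transform to the
    dependence relation turns it into the pointwise identity
      [p(z) F(z) = u(z) F(z + gamma)]   with [|u(z)| = 1]
    ([zak2_functional_eq]), because integer time-frequency shifts act on [F] as
    multiplication by characters.  So a zero of [F], or of [p], at [z] forces a
    zero of [F] at [z + gamma]: the set where [F] does not vanish is invariant
    under translation by [- gamma].  This set is also open, since the Zak
    transform of a Schwartz function is continuous ([continuous_zak2]), and it
    is invariant under the integer lattice.

    A rotation of a torus is recurrent: some arbitrarily large multiple of
    [gamma] is close to the lattice ([lattice_recurrence]).  Hence every point
    of the orbit closure [H] is approximated by multiples [n gamma] in which
    [n] may be taken as large as desired.  If [F(u) != 0] and [h] is in [H],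
    then a suitable forward translate of [u + h] lies, modulo the lattice, so
    close to [u] that [F] does not vanish there, and going backwards along the
    orbit gives [F(u + h) != 0] ([orbit_closure_forward]).  The same argument
    applied to [u + h + gamma] yields [F(u + h + gamma) != 0], and the
    functional equation then shows that [p(u + h) != 0].

    The analytic part is the absolute and locally uniform convergence of the
    series defining [F].  It is obtained from a single summable weight on the
    lattice, [k |-> prod_j 1 / (1 + k_j ^ 2)]: a Schwartz function is dominated
    by its continuous analogue, and translating by a bounded vector costs only
    a constant ([schwartz_translates_bound]). *)

Import Order.TTheory GRing.Theory Num.Theory.
Import numFieldNormedType.Exports.

Local Open Scope classical_set_scope.
Local Open Scope ring_scope.
Local Open Scope complex_scope.

Set Implicit Arguments.
Unset Strict Implicit.

(** * Dominated unordered sums of complex numbers *)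

Local Existing Instance summability.totally_filter.

Section UnorderedSums.
Context {R : realType} {I : choiceType}.
Implicit Types (a : I -> R) (g : I -> R[i]) (A B : {fset I}).

Lemma partial_sum_seq {V : zmodType} (g : I -> V) A :
  summability.partial_sum g A = \sum_(k <- A) g k.
Proof. by rewrite /summability.partial_sum -(big_seq_fsetE _ A xpredT g). Qed.

Lemma partial_sum_fsetD {V : zmodType} (g : I -> V) A B : (A `<=` B)%fset ->
  summability.partial_sum g B =
  summability.partial_sum g A + summability.partial_sum g (B `\` A)%fset.
Proof.
move=> /fsubsetP AB; rewrite !partial_sum_seq (big_fsetID _ (mem A)) /=.
congr (_ + _); apply: eq_fbigl => k; rewrite !inE/=.
  by apply/andP/idP => [[]//|kA]; split=> //; exact: AB.
by rewrite andbC.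
Qed.

Lemma le_partial_sum a A B : (forall k, 0 <= a k) -> (A `<=` B)%fset ->
  summability.partial_sum a A <= summability.partial_sum a B.
Proof.
move=> a0 AB; rewrite (partial_sum_fsetD _ AB) lerDl.
by rewrite partial_sum_seq sumr_ge0.
Qed.

Lemma norm_partial_sum_le a g A : (forall k, `|g k| <= (a k)%:C) ->
  `|summability.partial_sum g A| <= (summability.partial_sum a A)%:C.
Proof.
move=> ga; rewrite !partial_sum_seq; apply: (le_trans (ler_norm_sum _ _ _)).
by rewrite raddf_sum; apply: ler_sum.
Qed.

(** A nondecreasing net that is bounded above converges to its supremum. *)
Lemma cvg_nonneg_partial_sum a M : (forall k, 0 <= a k) ->
  (forall A, summability.partial_sum a A <= M) ->
  summability.partial_sum a @ summability.totally -->
    sup (range (summability.partial_sum a)).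
Proof.
move=> a0 aM; set E := range _.
have hE : has_sup E.
  split; first by exists (summability.partial_sum a fset0); exists fset0.
  by exists M => _ [A _ <-].
apply/cvgrPdist_le => e e0.
have [_ [A _ <-] hA] := sup_adherent e0 hE.
exists A => // B /= AB.
have hB : summability.partial_sum a B <= sup E.
  by apply: sup_upper_bound => //; exists B.
rewrite ger0_norm ?subr_ge0// lerBlDl -lerBlDr.
exact: (le_trans (ltW hA) (le_partial_sum a0 AB)).
Qed.

(** Absolute convergence implies convergence: [b = (b + a) - a] is a difference
    of two nonnegative families with bounded partial sums. *)
Lemma is_cvg_dominated_real a M (b : I -> R) : (forall k, `|b k| <= a k) ->
  (forall A, summability.partial_sum a A <= M) ->
  cvg (summability.partial_sum b @ summability.totally).
Proof.
move=> ba aM.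
have a0 k : 0 <= a k by exact: le_trans (ba k).
have ba0 k : 0 <= b k + a k.
  by have := ba k; rewrite ler_norml => /andP[+ _]; rewrite lerNl -subr_ge0 opprK addrC.
have psD A : summability.partial_sum (fun k => b k + a k) A =
    summability.partial_sum b A + summability.partial_sum a A.
  by rewrite !partial_sum_seq big_split.
have baM A : summability.partial_sum (fun k => b k + a k) A <= M + M.
  rewrite psD lerD//; apply: le_trans (aM A).
  by rewrite !partial_sum_seq; apply: ler_sum => k _; exact: le_trans (ler_norm _) (ba k).
have -> : summability.partial_sum b = summability.partial_sum (fun k => b k + a k)
    \- summability.partial_sum a by apply/funext => A /=; rewrite psD addrK.
by apply: is_cvgB; apply/cvg_ex; eexists; apply: cvg_nonneg_partial_sum; eauto.
Qed.

Lemma norm_le_ReIm (z : R[i]) :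
  `|z| <= (`|complex.Re z| + `|complex.Im z|)%:C.
Proof.
case: z => x y /=; have -> : x +i* y = x%:C + (0 +i* y) :> R[i] by simpc.
apply: le_trans (ler_normD _ _) _; rewrite rmorphD.
by rewrite !normc_def/= !expr0n/= addr0 add0r !sqrtr_sqr.
Qed.

(** The topology of [R[i]^o] comes from the complex modulus; this lemma compares
    it with the product topology, through which the completeness of [R] and the
    continuity of [cos] and [sin] are transferred to complex values. *)
Lemma cvg_complex (T : Type) (F : set_system T) {FF : Filter F}
    (h : T -> R[i]) (l1 l2 : R) :
  (complex.Re (h t) @[t --> F] --> l1) -> (complex.Im (h t) @[t --> F] --> l2) ->
  (h t : R[i]^o) @[t --> F] --> (l1 +i* l2 : R[i]^o).
Proof.
move=> h1 h2; apply/cvgrPdist_lt => e; rewrite ltcE /= => /andP[/eqP e2 e0].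
have e20 : 0 < complex.Re e / 2 by exact: divr_gt0.
move/cvgrPdist_lt: h1 => /(_ _ e20) h1; move/cvgrPdist_lt: h2 => /(_ _ e20).
apply: filterS2 h1 => t t1 t2; apply: le_lt_trans (norm_le_ReIm _) _.
rewrite (_ : e = (complex.Re e)%:C) ?ltcR; last first.
  by apply/eqP; rewrite eq_complex/= e2 !eqxx.
have -> : complex.Re e = complex.Re e / 2 + complex.Re e / 2 by field.
by case: (h t) t1 t2 => u v /= t1 t2; exact: ltrD.
Qed.

Lemma is_cvg_dominated_sum a M g : (forall k, `|g k| <= (a k)%:C) ->
  (forall A, summability.partial_sum a A <= M) ->
  cvg (summability.partial_sum (g : I -> R[i]^o) @ summability.totally).
Proof.
move=> ga aM.
have le1 k : `|complex.Re (g k)| <= a k.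
  by rewrite -lecR; apply: le_trans (ga k); exact: normc_ge_Re.
have le2 k : `|complex.Im (g k)| <= a k.
  rewrite -lecR; apply: le_trans (ga k); rewrite normc_def lecR.
  by rewrite -sqrtr_sqr ler_wsqrtr// lerDr sqr_ge0.
have psRe : summability.partial_sum (fun k => complex.Re (g k)) =
    fun A => complex.Re (summability.partial_sum g A).
  by apply/funext => A; rewrite !partial_sum_seq raddf_sum.
have psIm : summability.partial_sum (fun k => complex.Im (g k)) =
    fun A => complex.Im (summability.partial_sum g A).
  by apply/funext => A; rewrite !partial_sum_seq raddf_sum.
have := is_cvg_dominated_real le2 aM; rewrite psIm => /cvg_ex[l2 h2].
have := is_cvg_dominated_real le1 aM; rewrite psRe => /cvg_ex[l1 h1].
apply/cvg_ex; exists (l1 +i* l2).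
exact: (@cvg_complex _ _ (@summability.totally_filter I) _ _ _ h1 h2).
Qed.

(** The error bound depends on the dominating family only, so it makes the
    convergence uniform over all families [g] dominated by [a]. *)
Lemma dominated_sum_tail a M g A : (forall k, `|g k| <= (a k)%:C) ->
  (forall A, summability.partial_sum a A <= M) ->
  `|summability.sum (g : I -> R[i]^o) - summability.partial_sum g A| <=
  (sup (range (summability.partial_sum a)) - summability.partial_sum a A)%:C.
Proof.
move=> ga aM.
have a0 k : 0 <= a k by have := le_trans (normr_ge0 _) (ga k); rewrite -[0]/(0%:C) lecR.
have gc : summability.partial_sum (g : I -> R[i]^o) @ summability.totally -->
   summability.sum (g : I -> R[i]^o) := is_cvg_dominated_sum ga aM.
apply/ler_addgt0Pr => e e0.
(* Compare both terms with a partial sum over a set containing A that is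
   already within e of the limit. *)
move/cvgrPdist_lt: gc => /(_ _ e0)[B _ hB].
pose C := (A `|` B)%fset.
have AC : (A `<=` C)%fset by exact: fsubsetUl.
have /hB/= hC : (B `<=` C)%fset by exact: fsubsetUr.
set L := summability.sum _ in hC *; set SC := summability.partial_sum g C in hC *.
have -> : L - summability.partial_sum g A = (SC - summability.partial_sum g A) + (L - SC).
  by rewrite [RHS]addrC addrA subrK.
apply: le_trans (ler_normD _ _) _; apply: lerD; last exact: ltW.
rewrite /SC (partial_sum_fsetD g AC) [X in `|X - _|]addrC addrK.
apply: le_trans (norm_partial_sum_le _ ga) _; rewrite lecR.
rewrite lerBrDl -(partial_sum_fsetD a AC); apply: sup_upper_bound.
  split; first by exists (summability.partial_sum a fset0); exists fset0.
  by exists M => _ [? _ <-].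
by exists C.
Qed.

Lemma sum_lincomb {J : finType} (c : J -> R[i]) (g : J -> I -> R[i]) :
  (forall j, cvg (summability.partial_sum (g j : _ -> R[i]^o) @ summability.totally)) ->
  summability.sum (fun i => \sum_j c j * g j i : R[i]^o) =
  \sum_j c j * summability.sum (g j : _ -> R[i]^o).
Proof.
move=> gc; apply: cvg_lim => //.
rewrite (_ : summability.partial_sum _ =
    fun A => \sum_j c j * summability.partial_sum (g j) A); last first.
  apply/funext => A; rewrite partial_sum_seq exchange_big/=.
  by apply: eq_bigr => j _; rewrite partial_sum_seq mulr_sumr.
apply: cvg_big => [|j _]; first exact: add_continuous.
exact: (cvgM (cvg_cst (c j : R[i]^o)) (gc j)).
Qed.

Lemma sum_scale (c : R[i]) (g : I -> R[i]) :
  cvg (summability.partial_sum (g : _ -> R[i]^o) @ summability.totally) ->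
  summability.sum (fun i => c * g i : R[i]^o) = c * summability.sum (g : _ -> R[i]^o).
Proof.
move=> gc; have := @sum_lincomb unit (fun=> c) (fun=> g) (fun=> gc).
by rewrite big_const card_unit/= addr0 => <-; congr summability.sum; apply/funext => k;
  rewrite big_const card_unit/= addr0.
Qed.

End UnorderedSums.

(** * Decay of Schwartz functions along the lattice *)

Section Decay.
Context {R : realType} {d : nat}.
Implicit Types (f : 'rV[R]_d -> R[i]) (t u w : 'rV[R]_d) (k : 'rV[int]_d).

Definition lattice_weight k : R := \prod_(j < d) (1 + (k 0 j)%:~R ^+ 2)^-1.

Lemma addsq1_gt0 (s : R) : 0 < 1 + s ^+ 2.
Proof. by rewrite ltr_pwDl// sqr_ge0. Qed.

Lemma lattice_weight_ge0 k : 0 <= lattice_weight k.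
Proof. by apply: prodr_ge0 => j _; rewrite invr_ge0 ltW// addsq1_gt0. Qed.

(** The series telescopes after the comparison
    [1 / (1 + n ^ 2) <= 3 / ((n + 1) (n + 2))], which for an integer [n] amounts
    to [0 <= (n - 1) (2 n - 1)]. *)
Lemma sum_inv_addsq1_le m : \sum_(n < m) (1 + n%:R ^+ 2)^-1 <= 3 :> R.
Proof.
suff : \sum_(n < m) (1 + n%:R ^+ 2)^-1 <= 3 - 3 / (m%:R + 1) :> R.
  move=> h; apply: le_trans h _; rewrite lerBlDr lerDl.
  by apply: divr_ge0 => //; apply: addr_ge0.
elim: m => [|m IH]; first by rewrite big_ord0 add0r divr1 subrr.
rewrite big_ord_recr/=; apply: le_trans (lerD IH (lexx _)) _.
have m0 : 0 <= m%:R :> R by [].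
have hm : 0 <= (m%:R - 1) * (2 * m%:R - 1) :> R.
  case: m {IH m0} => [|m]; first by rewrite mulr0 !sub0r mulrNN mulr1.
  have : 0 <= m%:R :> R by [].
  by rewrite -[m.+1]addn1 natrD => ?; nra.
rewrite -[m.+1]addn1 natrD -subr_ge0.
have -> : 3 - 3 / (m%:R + 1 + 1) - (3 - 3 / (m%:R + 1) + (1 + m%:R ^+ 2)^-1) =
   (m%:R - 1) * (2 * m%:R - 1) / ((m%:R + 1) * (m%:R + 1 + 1) * (1 + m%:R ^+ 2)) :> R.
  have := addsq1_gt0 m%:R; move: m%:R m0 {hm IH} => s s0 hs.
  by field; rewrite !gt_eqF//; lra.
by rewrite divr_ge0// !mulr_ge0// ?addr_ge0// sqr_ge0.
Qed.

(** A finite set of lattice points lies in a box, over which the sum of a product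
    of one-variable functions factors.  Each factor runs over signs and absolute
    values, and so is at most [2 * 3]. *)
Lemma partial_sum_lattice_weight_le (A : {fset 'rV[int]_d}) :
  summability.partial_sum lattice_weight A <= 6 ^+ d.
Proof.
(* Points are coded by their signs and absolute values; the code is injective
   on A, so the sum over A is bounded by the sum over all codes. *)
pose m := (\max_(k <- A) \max_(j < d) `|k ord0 j|%N)%N.
pose code k : {ffun 'I_d -> bool * 'I_m.+1} :=
  [ffun j => (k 0 j < 0, inord `|k ord0 j|%N)].
pose G (h : {ffun 'I_d -> bool * 'I_m.+1}) : R :=
  \prod_j (1 + (h j).2%:R ^+ 2)^-1.
have codeE k j : k \in A -> ((code k j).2 : nat) = `|k ord0 j|%N.
  move=> kA; rewrite ffunE/= inordK// ltnS.
  apply: (@leq_trans (\max_(j < d) `|k ord0 j|%N)%N); first exact: leq_bigmax.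
  by apply: (@leq_bigmax_seq _ _ xpredT (fun k => \max_(j < d) `|k ord0 j|%N)%N).
have wE k : k \in A -> lattice_weight k = G (code k).
  move=> kA; apply: eq_bigr => j _; rewrite codeE//; congr (1 + _)^-1.
  rewrite [in LHS](intEsign (k 0 j)) rmorphM rmorphXn/= rmorphN1 exprMn.
  by rewrite -exprM mulnC exprM sqrrN expr1n expr1n mul1r.
have code_inj : {in A &, injective code}.
  move=> k l kA lA kl; apply/rowP => j.
  rewrite (intEsign (k 0 j)) (intEsign (l 0 j)) -(codeE k)// -(codeE l)// kl.
  by have := congr1 (fun h : {ffun 'I_d -> bool * 'I_m.+1} => (h j).1) kl; rewrite !ffunE/= => ->.
rewrite partial_sum_seq big_seq (eq_bigr _ wE) -big_seq.
rewrite -(big_map code xpredT G) big_uniq/=; last first.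
  by rewrite map_inj_in_uniq// fset_uniq.
have G0 h : 0 <= G h by apply: prodr_ge0 => j _; rewrite invr_ge0 ltW// addsq1_gt0.
rewrite big_mkcond/=; apply: (@le_trans _ _ (\sum_h G h)).
  by apply: ler_sum => h _; case: ifP.
rewrite /G -(bigA_distr_bigA
  (fun (_ : 'I_d) (p : bool * 'I_m.+1) => (1 + p.2%:R ^+ 2)^-1 : R)).
rewrite -[X in _ ^+ X](card_ord d) -prodr_const; apply: ler_prod => j _.
rewrite sumr_ge0/=; last by move=> p _; rewrite invr_ge0 ltW// addsq1_gt0.
rewrite -(pair_bigA _ (fun (_ : bool) (n : 'I_m.+1) => (1 + n%:R ^+ 2)^-1 : R))/=.
rewrite big_bool/= (_ : 6 = 3 + 3 :> R); last by ring.
by apply: lerD; exact: sum_inv_addsq1_le.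
Qed.

(** Expanding [prod_j (1 + t_j ^ 2)] gives a sum of monomials, and each of them
    times [f] is bounded. *)
Lemma schwartz_decay f : schwartz f -> exists2 C : R, 0 <= C &
  forall t, `|f t| <= (C * \prod_(j < d) (1 + t 0 j ^+ 2)^-1)%:C.
Proof.
move=> [_ hf].
pose b (J : {set 'I_d}) (j : 'I_d) := if j \in J then 0%N else 2%N.
have /choice[M hM] J : exists M : R, forall t, `|(monomial (b J) t)%:C * f t| <= M%:C.
  exact: (hf (b J) [::]).
have M0 J : 0 <= M J.
  by have := le_trans (normr_ge0 _) (hM J 0); rewrite -[0]/(0%:C) lecR.
exists (\sum_J M J); first exact: sumr_ge0.
move=> t.
have P0 : 0 < \prod_(j < d) (1 + t 0 j ^+ 2).
  by apply: prodr_gt0 => j _; exact: addsq1_gt0.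
rewrite prodfV rmorphM/= fmorphV ler_pdivlMr; last by rewrite -[0]/(0%:C) ltcR.
have -> : \prod_(j < d) (1 + t 0 j ^+ 2) = \sum_J monomial (b J) t.
  rewrite (bigA_distr _ _ (fun=> 1) (fun j => t 0 j ^+ 2)); apply: eq_bigr => J _.
  by apply: eq_bigr => j _; rewrite /b; case: ifP => //; rewrite expr0.
have m0 J : 0 <= monomial (b J) t.
  by apply: prodr_ge0 => j _; rewrite /b; case: ifP => _; rewrite ?expr0// sqr_ge0.
rewrite !rmorph_sum/= mulr_sumr; apply: ler_sum => J _.
rewrite mulrC; apply: le_trans (hM J t); rewrite normrM.
by rewrite ler_wpM2r// normc_def/= expr0n addr0 sqrtr_sqr ger0_norm.
Qed.

(** Peetre's inequality in one variable, from
    [k ^ 2 <= 2 (s + k) ^ 2 + 2 s ^ 2]. *)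
Lemma peetre (s k B : R) : s ^+ 2 <= B ->
  (1 + (s + k) ^+ 2)^-1 <= 2 * (1 + B) * (1 + k ^+ 2)^-1.
Proof.
move=> sB; rewrite ler_pdivlMr ?addsq1_gt0// ler_pdivrMl ?addsq1_gt0//.
have h1 : 0 <= (s + (s + k)) ^+ 2 by exact: sqr_ge0.
have h2 : 0 <= B * (s + k) ^+ 2.
  by rewrite mulr_ge0 ?sqr_ge0// (le_trans _ sB)// sqr_ge0.
nra.
Qed.

(** The constant is uniform near [u] and the weight is the same at all points:
    this is what makes the Zak series converge locally uniformly. *)
Lemma schwartz_translates_bound f u : schwartz f -> exists2 C : R, 0 <= C &
  \forall t \near u, forall k, `|f (t + vecint k)| <= (C * lattice_weight k)%:C.
Proof.
move=> /schwartz_decay[C C0 hC].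
exists (C * \prod_(j < d) (2 * (1 + (`|u 0 j| + 1) ^+ 2))).
  by rewrite mulr_ge0// prodr_ge0// => j _; rewrite mulr_ge0// ltW// addsq1_gt0.
have := nbhsx_ballx u _ (@ltr01 R); apply: filterS => t [_ /(_ 0) ut] k.
apply: le_trans (hC _) _; rewrite lecR -mulrA.
rewrite ler_wpM2l// -big_split/=; apply: ler_prod => j _.
rewrite invr_ge0 ltW ?addsq1_gt0//= !mxE; apply: peetre.
rewrite -real_normK ?num_real// lerXn2r ?nnegrE ?addr_ge0//.
rewrite -lerBlDl; apply: le_trans (ltW (ut j)).
by rewrite distrC; exact: lerB_dist.
Qed.

End Decay.

(** * The Zak transform of a Schwartz function *)

Section Zak.
Context {R : realType} {d : nat}.
Implicit Types (f : 'rV[R]_d -> R[i]) (t w : 'rV[R]_d) (k x : 'rV[int]_d)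
  (z : 'rV[R]_(d + d)).

Definition zak_term f t w k : R[i] :=
  expi (- (2 * pi * dot w (vecint k))) * f (t + vecint k).

Lemma norm_zak_term f t w k : `|zak_term f t w k| = `|f (t + vecint k)|.
Proof. by rewrite normrM norm_expi mul1r. Qed.

Lemma partial_sum_scaled_weight_le (C : R) (A : {fset 'rV[int]_d}) : 0 <= C ->
  summability.partial_sum (fun k => C * lattice_weight k) A <= C * 6 ^+ d.
Proof.
move=> C0; rewrite partial_sum_seq -mulr_sumr -partial_sum_seq.
by rewrite ler_wpM2l// partial_sum_lattice_weight_le.
Qed.

Lemma is_cvg_zak f t w (hf : schwartz f) :
  cvg (summability.partial_sum (zak_term f t w : _ -> R[i]^o) @ summability.totally).
Proof.
have [C C0 /nbhs_singleton hC] := schwartz_translates_bound t hf.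
apply: (@is_cvg_dominated_sum _ _ (fun k => C * lattice_weight k) (C * 6 ^+ d)).
  by move=> k; rewrite norm_zak_term.
by move=> A; exact: partial_sum_scaled_weight_le.
Qed.

Lemma continuous_expi : continuous (expi : R -> R[i]^o).
Proof.
move=> s; exact: (@cvg_complex R R (nbhs s) _ (fun s => expi s) (cos s) (sin s)
  (@continuous_cos R s) (@continuous_sin R s)).
Qed.

(** Continuity is stated along arbitrary continuous families of arguments [t] and
    [w]; the case of interest is the two halves of a point of phase space. *)
Lemma continuous_zak_term (T : topologicalType) (t w : T -> 'rV[R]_d) f k :
  schwartz f -> continuous t -> continuous w ->
  continuous (fun v => zak_term f (t v) (w v) k : R[i]^o).
Proof.
move=> [/(_ [::])[_ /= fc] _] tc wc z.
have dotc : dot (w v) (vecint k) @[v --> z] --> dot (w z) (vecint k).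
  rewrite /dot; apply: cvg_big => [|j _]; first exact: add_continuous.
  apply: cvgM; last exact: cvg_cst.
  exact: (continuous_cvg _ (@coord_continuous R 1 d 0 j (w z)) (wc z)).
have phc : (- (2 * pi * dot (w v) (vecint k)) : R) @[v --> z] -->
    (- (2 * pi * dot (w z) (vecint k)) : R).
  exact: (cvgN (cvgM (cvg_cst (2 * pi)) dotc)).
have expc : (expi (- (2 * pi * dot (w v) (vecint k))) : R[i]^o) @[v --> z] -->
    (expi (- (2 * pi * dot (w z) (vecint k))) : R[i]^o).
  exact: (continuous_cvg _ (@continuous_expi _) phc).
have shiftc : t v + vecint k @[v --> z] --> t z + vecint k.
  exact: (cvgD (tc z) (cvg_cst (vecint k))).
have fshiftc : (f (t v + vecint k) : R[i]^o) @[v --> z] -->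
    (f (t z + vecint k) : R[i]^o).
  exact: (continuous_cvg _ (fc _) shiftc).
exact: (cvgM expc fshiftc).
Qed.

Lemma continuous_partial_zak (T : topologicalType) (t w : T -> 'rV[R]_d) f
    (A : {fset 'rV[int]_d}) :
  schwartz f -> continuous t -> continuous w ->
  continuous (fun v => summability.partial_sum (zak_term f (t v) (w v)) A : R[i]^o).
Proof.
move=> hf tc wc; under eq_fun do rewrite partial_sum_seq.
apply: continuous_big => [|k _]; first exact: add_continuous.
exact: continuous_zak_term.
Qed.

(** A locally uniform limit of continuous functions is continuous: one finite
    partial sum is within [r] of the whole sum at all points near [z]. *)
Lemma continuous_zak (T : topologicalType) (t w : T -> 'rV[R]_d) f :
  schwartz f -> continuous t -> continuous w ->
  continuous (fun v => zak f (t v) (w v) : R[i]^o).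
Proof.
move=> hf tc wc z; apply/cvgrPdist_lt => e; rewrite ltcE /= => /andP[/eqP ei e0].
have [C C0 hC] := schwartz_translates_bound (t z) hf.
pose a k := C * lattice_weight k.
have aM A : summability.partial_sum a A <= C * 6 ^+ d.
  exact: partial_sum_scaled_weight_le.
pose r := complex.Re e / 3; have r0 : 0 < r by exact: divr_gt0.
have -> : e = r%:C + r%:C + r%:C.
  by apply/eqP; rewrite eq_complex/= ei !addr0 eqxx andbT; apply/eqP; rewrite /r; field.
have a0 k : 0 <= a k by rewrite mulr_ge0// lattice_weight_ge0.
have := cvg_nonneg_partial_sum a0 aM.
move=> /cvgrPdist_lt /(_ r r0)[A _ /(_ A (fsubset_refl A)) /= hA].
have tail : \forall v \near z, `|zak f (t v) (w v) - summability.partial_sum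
    (zak_term f (t v) (w v)) A| < r%:C.
  have nearC : \forall v \near z, forall k, `|f (t v + vecint k)| <= (a k)%:C := tc z _ hC.
  apply: filterS nearC => v hv.
  apply: le_lt_trans (@dominated_sum_tail _ _ a _ (zak_term f (t v) (w v)) A _ aM) _.
    by move=> k; rewrite norm_zak_term.
  by rewrite ltcR; apply: le_lt_trans hA; exact: ler_norm.
have cA := @continuous_partial_zak _ _ _ _ A hf tc wc z.
have r0C : 0 < r%:C by rewrite -[0]/(0%:C) ltcR.
have tz := nbhs_singleton tail.
move/cvgrPdist_lt: cA => /(_ _ r0C) cA.
apply: filterS (filterI tail cA) => v [tv cv].
set Sz := summability.partial_sum _ A in cv tz; set Sv := summability.partial_sum _ A in tv cv.
have -> : zak f (t z) (w z) - zak f (t v) (w v) =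
    (zak f (t z) (w z) - Sz) + (Sz - Sv) + (Sv - zak f (t v) (w v)).
  by rewrite !addrA !subrK.
apply: le_lt_trans (ler_normD _ _) _; apply: ltrD; last by rewrite distrC.
by apply: le_lt_trans (ler_normD _ _) _; apply: ltrD.
Qed.

Lemma continuous_zak2 f : schwartz f -> continuous (zak2 f : _ -> R[i]^o).
Proof.
by move=> hf; apply: continuous_zak => // z; [exact: continuous_lsubmx | exact: continuous_rsubmx].
Qed.

(** The identity that moves a time-frequency shift of [f] to the arguments of its
    Zak transform holds term by term, for arbitrary real shifts. *)
Lemma zak_term_shift f (alpha beta : 'rV[R]_d) t w k :
  zak_term (modulation beta (translation alpha f)) t w k =
  expi (- (2 * pi * dot beta t)) * zak_term f (t - alpha) (w + beta) k.
Proof.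
rewrite /zak_term /modulation /translation dotDl dotDr !expiND !mulrA addrAC.
by congr (_ * _); rewrite -!mulrA mulrCA.
Qed.

(** Quasi-periodicity in time: translating the index set of the series by [x]
    produces the phase. *)
Lemma zak_translate_int f t w x : schwartz f ->
  zak f (t - vecint x) w = expi (- (2 * pi * dot w (vecint x))) * zak f t w.
Proof.
move=> hf.
have -> : zak f t w = expi (2 * pi * dot w (vecint x)) * zak f (t - vecint x) w.
  rewrite /zak -(sum_shift (fun k => zak_term f t w k : R[i]^o) (- x)).
  rewrite -(sum_scale _ (is_cvg_zak hf)).
  apply: (congr1 (fun g : 'rV[int]_d -> R[i]^o => summability.sum g)).
  apply/funext => k; rewrite /zak_term.
  have -> : t + vecint (k - x) = t - vecint x + vecint k.
    by rewrite vecintD [vecint (- x)]raddfN addrAC addrA.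
  rewrite -[in RHS](subrK x k) [in RHS]vecintD dotDr expiND mulrA.
  rewrite [expi (2 * _ * _) * _]mulrCA -expiD addrN expi0 mulr1.
  by rewrite -vecintD subrK.
by rewrite mulrA -expiD addNr expi0 mul1r.
Qed.

End Zak.

Lemma open_zak2_neq0 {R : realType} {d : nat} (f : 'rV[R]_d -> R[i]) :
  schwartz f -> open [set z | zak2 f z != 0].
Proof.
move=> hf; have fc := @continuous_zak2 _ _ f hf.
pose F : 'rV[R]_(d + d) -> R[i]^o := zak2 f.
rewrite -[X in open X]/(F @^-1` [set v | v != 0]).
apply: open_comp => [v _|]; first exact: fc.
have -> : [set v : R[i]^o | v != 0] = ~` [set 0].
  by apply/seteqP; split=> v /=; [move/eqP | move=> /eqP].
apply: closed_openC.
apply: accessible_closed_set1; apply: hausdorff_accessible; exact: norm_hausdorff.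
Qed.

(** * Recurrence of torus rotations *)

Section Recurrence.
Context {R : realType} {n : nat}.
Implicit Types (g u v h l : 'rV[R]_n).

Lemma tprojD : {morph @tproj R n : u v / u + v}.
Proof. by move=> u v; exact: raddfD. Qed.

Lemma mx_norm_lt v (e : R) : 0 < e -> (forall j, `|v 0 j| < e) -> `|v| < e.
Proof.
move=> e0 ve; have : ball v e 0.
  by split=> // i j; rewrite ord1 /ball/= mxE subr0.
by rewrite mx_norm_ball /ball_/= subr0.
Qed.

(** Dirichlet's pigeonhole argument, applied to the multiples [i * K] of [g] so
    that the difference of two of them is a multiple of [g] by at least [K]:
    two fractional parts in the same box of side [1 / Q] differ by less than
    [1 / Q < e]. *)
Lemma lattice_recurrence g (e : R) (K : nat) : 0 < e ->
  exists2 m, (K <= m)%N & exists2 l, l \in int_lattice & `|g *+ m - l| < e.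
Proof.
move=> e0.
pose Q := (Num.trunc e^-1).+1.
have Qe : Q%:R^-1 < e.
  by rewrite -[e]invrK ltf_pV2 ?posrE ?invr_gt0// /Q truncnS_gt.
pose a (i : nat) (j : 'I_n) : R := (i * K)%:R * g 0 j.
pose frac i j : R := a i j - (Num.floor (a i j))%:~R.
have frac_itv i j : 0 <= frac i j < 1.
  by rewrite /frac subr_ge0 ltrBlDl floor_le_tmp/= -[X in _ + X]/(1%:~R) -intrD floorD1_gt.
have Qfrac0 i j : 0 <= Q%:R * frac i j by rewrite mulr_ge0//; case/andP: (frac_itv i j).
pose box (i : nat) : {ffun 'I_n -> 'I_Q} := [ffun j => inord (Num.trunc (Q%:R * frac i j))].
have boxE i j : (box i j : nat) = Num.trunc (Q%:R * frac i j).
  rewrite ffunE inordK// truncn_lt_nat//.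
  by rewrite gtr_pMr//; case/andP: (frac_itv i j).
have [i1 [i2 [i12 boxi]]] : exists i1 i2 : nat, (i1 < i2)%N /\ box i1 = box i2.
  pose T : finType := {ffun 'I_n -> 'I_Q}.
  have /injectivePn[i1 [i2 i12 bi]] : ~~ injectiveb (fun i : 'I_(#|T|.+1) => box i).
    by apply/injectiveP => /leq_card; rewrite card_ord ltnn.
  have [lt12|lt21|/val_inj eq12] := ltngtP i1 i2; last by rewrite eq12 eqxx in i12.
    by exists i1, i2.
  by exists i2, i1.
exists ((i2 - i1) * K)%N; first by rewrite leq_pmull// subn_gt0.
exists (\row_j ((Num.floor (a i2 j))%:~R - (Num.floor (a i1 j))%:~R)).
  by apply/forallP => j; rewrite mxE rpredB// intr_int.
apply: mx_norm_lt => // j; rewrite !mxE mulmxnE.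
have -> : g 0 j *+ ((i2 - i1) * K) - ((Num.floor (a i2 j))%:~R - (Num.floor (a i1 j))%:~R)
    = frac i2 j - frac i1 j.
  rewrite -mulr_natl /frac /a !natrM natrB ?(ltnW i12)//; ring.
apply: lt_trans Qe; rewrite -[ltRHS]mul1r ltr_pdivlMr// -[X in _ * X]normr_nat -normrM.
have := truncn_itv (Qfrac0 i1 j); have := truncn_itv (Qfrac0 i2 j).
rewrite -!boxE boxi -natr1 ltr_norml => /andP[h1 h2] /andP[h3 h4].
by apply/andP; split; lra.
Qed.

(** The projection onto the torus is an open map: the preimage of the image of a
    ball is the union of the lattice translates of that ball. *)
Lemma tproj_nbhs h (e : R) : 0 < e ->
  nbhs (tproj h) [set z | exists2 v, tproj v = z & `|h - v| < e].
Proof.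
move=> e0; rewrite nbhsE; exists [set z | exists2 v, tproj v = z & `|h - v| < e] => //.
split; last by exists h; rewrite // subrr normr0.
rewrite /open/= /torus_open.
rewrite (_ : tproj @^-1` _ =
    \bigcup_(l in [set l | l \in int_lattice]) [set v | `|h - (v + l)| < e]).
  apply: bigcup_open => l _.
  rewrite (_ : [set v | _] = ball (h - l) e); first exact: ball_open.
  by rewrite mx_norm_ball; apply/funext => v; rewrite /ball_/= opprD addrA addrAC.
apply/seteqP; split=> v /=.
  move=> [w wv hw]; exists (w - v); last by rewrite /= [v + _]addrC subrK.
  by rewrite /= -tproj_eq wv.
move=> [l /= ll hl]; exists (v + l) => //; apply/eqP.
by rewrite tproj_eq [v + l]addrC addrK.
Qed.

(** An open lattice-periodic set stable under [- g] that contains [u] contains the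
    forward orbit of each point of [u + H], [H] being the closure of the orbit of
    [g]: recurrence moves points of the two-sided orbit arbitrarily far
    forward. *)
Lemma orbit_closure_forward (U : set 'rV[R]_n) g u h :
  open U -> (forall v l, l \in int_lattice -> U v -> U (v + l)) ->
  (forall v, U (v + g) -> U v) -> U u ->
  closure (range (fun m : int => tproj (g *~ m))) (tproj h) ->
  forall j : nat, U (u + h + g *+ j).
Proof.
move=> oU UL Ug Uu hh j.
have Ugn v m : U (v + g *+ m) -> U v.
  elim: m => [|m IH]; first by rewrite mulr0n addr0.
  by rewrite mulrSr addrA => /Ug/IH.
have [e /= e0 he] := (nbhs_ballP u U).1 (open_nbhs_nbhs (conj oU Uu)).
have e20 : 0 < e / 2 by rewrite divr_gt0.
have [_ [[m _ <-] [v]]] := hh _ (tproj_nbhs h e20).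
move=> /eqP; rewrite tproj_eq => vm hv.
have [k jk [l ll kl]] := lattice_recurrence g (`|m| + j)%N e20.
(* As k >= |m| + j, the point u + h + j g still has to advance by q >= 0 steps
   to come near u modulo the lattice. *)
have [q qE] : exists q : nat, k%:Z = m + j%:Z + q%:Z.
  exists `|(k%:Z - m - j%:Z)%R|%N; lia.
apply: (Ugn _ q).
have -> : u + h + g *+ j + g *+ q = (u + (h - v) + (g *+ k - l)) + (l + (v - g *~ m)).
  rewrite -[g *+ k]/(g *~ k%:Z) qE !mulrzDr -!pmulrn.
  by apply/rowP => c; rewrite !mxE; ring.
apply: UL; first by rewrite rpredD.
apply: he; rewrite mx_norm_ball /ball_/= -addrA opprD addNKr.
rewrite normrN; apply: le_lt_trans (ler_normD _ _) _.
by rewrite [ltRHS](splitr e) ltrD.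
Qed.

End Recurrence.

(** * The functional equation *)

Section FunctionalEquation.
Context {R : realType} {d : nat}.
Implicit Types (f : 'rV[R]_d -> R[i]) (t w : 'rV[R]_d) (x y : 'rV[int]_d).

Lemma zak_frequency_int f t w y : zak f t (w + vecint y) = zak f t w.
Proof.
rewrite /zak; apply: (congr1 (fun g : 'rV[int]_d -> R[i]^o => summability.sum g)).
apply/funext => k; rewrite dotDl expiND.
by rewrite (expiN_int (dot_int (vecint_int _) (vecint_int _))) mulr1.
Qed.

(** Both sides are the Zak transform of the same function: the dependence
    relation is used at the points [t + k] of the series, and the shifts by the
    integer vectors [x k], [y k] come out as the characters forming
    [trig_poly]. *)
Lemma zak2_functional_eq (m : nat) (c : 'I_m -> R[i]) (x y : 'I_m -> 'rV[int]_d)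
    (alpha beta : 'rV[R]_d) f (z : 'rV[R]_(d + d)) :
  schwartz f ->
  (forall t, \sum_(k < m) c k * modulation (vecint (y k)) (translation (vecint (x k)) f) t
    = modulation beta (translation alpha f) t) ->
  trig_poly c x y z * zak2 f z =
  expi (- (2 * pi * dot beta (lsubmx z))) * zak2 f (z + row_mx (- alpha) beta).
Proof.
move=> hf hdep; rewrite /zak2 /trig_poly [lsubmx (_ + _)]raddfD [rsubmx (_ + _)]raddfD/=.
rewrite row_mxKl row_mxKr; move: (lsubmx z) (rsubmx z) => t w {z}.
have := sum_scale (expi (- (2 * pi * dot beta t))) (is_cvg_zak (t := t - alpha) (w := w + beta) hf).
rewrite -/(zak f (t - alpha) (w + beta)) => <-.
(* Term by term, the right-hand series is a combination of the series for the
   integer shifts. *)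
pose e k := c k * expi (- (2 * pi * dot (vecint (y k)) t)).
pose g k := zak_term f (t - vecint (x k)) (w + vecint (y k)).
transitivity (summability.sum (fun l => \sum_k e k * g k l : R[i]^o)); last first.
  apply: (congr1 (fun g : 'rV[int]_d -> R[i]^o => summability.sum g)).
  apply/funext => l; rewrite -zak_term_shift /zak_term -hdep mulr_sumr.
  apply: eq_bigr => k _.
  by rewrite /e /g -mulrA -zak_term_shift /zak_term mulrCA.
rewrite sum_lincomb => [|k]; last exact: is_cvg_zak.
rewrite mulr_suml; apply: eq_bigr => k _.
rewrite -[summability.sum _]/(zak f (t - vecint (x k)) (w + vecint (y k))).
by rewrite zak_frequency_int zak_translate_int// mulrA.
Qed.

Lemma trig_poly_neq0_of_shift (m : nat) (c : 'I_m -> R[i]) (x y : 'I_m -> 'rV[int]_d)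
    (alpha beta : 'rV[R]_d) f (z : 'rV[R]_(d + d)) :
  schwartz f ->
  (forall t, \sum_(k < m) c k * modulation (vecint (y k)) (translation (vecint (x k)) f) t
    = modulation beta (translation alpha f) t) ->
  zak2 f (z + row_mx (- alpha) beta) != 0 ->
  trig_poly c x y z != 0 /\ zak2 f z != 0.
Proof.
move=> hf hdep zg; apply/andP; rewrite -negb_or -mulf_eq0.
rewrite (zak2_functional_eq z hf hdep) mulf_neq0//.
by rewrite -normr_eq0 norm_expi oner_eq0.
Qed.

End FunctionalEquation.

(** * Cosets of the orbit closure *)

Unset Implicit Arguments.
Set Strict Implicit.

Theorem proposition3p1 (R : realType) (d N : nat) (hd : (1 <= d)%N)
    (hN : (2 <= N)%N) (x y : 'I_N.-1 -> 'rV[int]_d) (alpha beta : 'rV[R]_d)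
    (hab : ~~ ((alpha \in int_lattice) && (beta \in int_lattice)))
    (f : 'rV[R]_d -> R[i]) (hf : schwartz f) (hf0 : f <> (fun=> 0))
    (c : 'I_N.-1 -> R[i])
    (hdep : forall t : 'rV[R]_d,
      \sum_(k < N.-1)
        c k * modulation (vecint (y k)) (translation (vecint (x k)) f) t
      = modulation beta (translation alpha f) t) :
  let gamma : 'rV[R]_(d + d) := row_mx (- alpha) beta in
  let H := orbit_closure gamma in
  let p := on_torus (trig_poly c x y) in
  let S := zak_support f in
  (forall z, S z -> torus_coset z H `<=` S) /\
  (forall z, S z -> forall w : torus R (d + d), torus_coset z H w -> p w != 0).
Proof.
move=> gamma H p S.
pose U := [set v | zak2 f v != 0].
have openU : open U by exact: open_zak2_neq0.
have latticeU v l : l \in int_lattice -> U v -> U (v + l).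
  move=> ll /(zak_supportE f v).2 Sv; apply: (zak_supportE f (v + l)).1.
  have -> : tproj (v + l) = tproj v; last exact: Sv.
  by apply/eqP; rewrite tproj_eq [v + l]addrC addrK.
have backU v : U (v + gamma) -> trig_poly c x y v != 0 /\ U v.
  exact: trig_poly_neq0_of_shift.
have cosetU z w : S z -> torus_coset z H w -> exists v, [/\ w = tproj v, U v & U (v + gamma)].
  move=> Sz [h Hh <-]; exists (repr z + repr h).
  have Uz : U (repr z) by apply: (zak_supportE f (repr z)).1; rewrite tproj_surj.
  rewrite -[h]tproj_surj in Hh.
  have orbU := orbit_closure_forward openU latticeU (fun v Uv => (backU v Uv).2) Uz Hh.
  split; last by have := orbU 1%N; rewrite mulr1n.
    by rewrite tprojD !tproj_surj.
  by have := orbU 0%N; rewrite mulr0n addr0.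
split=> z Sz w.
  by move=> /(cosetU _ _ Sz)[v [-> Uv _]]; exact: (zak_supportE f v).2.
move=> /(cosetU _ _ Sz)[v [-> _ /backU[pv _]]].
by rewrite /p (on_torusE _ (trig_poly_zperiodic c x y)).
Qed.
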